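(* Let $p$ be a prime, $q$ a power of $p$, $n\ge1$ odd, $m=\frac{q^n+1}{q+1}$, and let $G\le B(Q_\infty)$ be a subgroup. Then, up to replacing $G$ by a conjugate subgroup in $B(Q_\infty)$, the associated data $G_0,G_2,G_3$ satisfy: (i) $G_0$ is a cyclic subgroup of $\mu$, the group of $m(q^2-1)$-th roots of unity in $\mathbb{F}_{q^{2n}}^*$; (ii) $G_2\subset\mathbb{F}_{q^2}$ is a vector space over $\mathbb{F}_p(G_0^m)$; (iii) $G_3\subset\{c\in\mathbb{F}_{q^2}\mid c^q+c=0\}$ is a vector space over $\mathbb{F}_p(G_0^{q^n+1})$ containing $W$, where $W=\{b_1b_2^q-b_2b_1^q\mid b_1,b_2\in G_2\}$ if $p$ is odd and $W=\{b^{q+1}\mid b\in G_2\}$ if $p=2$. Conversely, for any $G_0,G_2,G_3$ satisfying (i), (ii) and (iii) there exists a subgroup $G\le B(Q_\infty)$ giving rise to this triple.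
   Context: Let $\mathcal C_n=\mathbb{F}_{q^{2n}}(x,y,z)$ be the function field defined by $x^q+x=y^{q+1}$ and $z^m=y^{q^2}-y$. Let $A(P_\infty)$ be the group of symbols $[a,b,c]$ with $a\in\mathbb{F}_{q^2}^*$, $b,c\in\mathbb{F}_{q^2}$, $c^q+c=b^{q+1}$, group law $[a',b',c']\circ[a,b,c]=[a'a,ab'+b,a^{q+1}c'+ab^qb'+c]$. Let $B(Q_\infty)$ be the group of automorphisms $[a,b,c,d]$ of $\mathcal C_n$ given by $x\mapsto a^{q+1}x+ab^qy+c$, $y\mapsto ay+b$, $z\mapsto dz$, where $a\in\mathbb{F}_{q^2}^*$, $b,c\in\mathbb{F}_{q^2}$, $c^q+c=b^{q+1}$, $d\in\mathbb{F}_{q^{2n}}$, $d^m=a$, with group law $[a',b',c',d']\circ[a,b,c,d]=[a'a,ab'+b,a^{q+1}c'+ab^qb'+c,d'd]$. Let $\pi([a,b,c,d])=[a,b,c]$ and $\pi_d([a,b,c,d])=d$. For a subgroup $G$: $G_0=\pi_d(G)$; $U=\{[1,b,c]\in\pi(G)\}$; $G_2=\{b:[1,b,c]\in U\}$ (image of $\psi:U\to\mathbb{F}_{q^2}$, $[1,b,c]\mapsto b$); $G_3=\{c:[1,0,c]\in\pi(G)\}$ (the kernel of $\psi$, identified with a subset of $\mathbb{F}_{q^2}$). For $S\subset\mathbb{F}_{q^{2n}}$ and integer $i$, $S^i=\{s^i:s\in S\}$ and $\mathbb{F}_p(S)$ denotes the field generated over $\mathbb{F}_p$ by $S$. *)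

(* Defs.v *)
From HB Require Import structures.
From mathcomp Require Import all_boot all_order all_algebra.
Set Implicit Arguments. Unset Strict Implicit. Unset Printing Implicit Defensive.
Import GRing.Theory.
Local Open Scope ring_scope.

(* The ambient field F_{q^{2n}} is an abstract finite field L of that order. *)
Section Defs.
Variable L : finFieldType.

(* Fixed points of x |-> x^r ; for r = q^2 this is the subfield F_{q^2}. *)
Definition Fsub (r : nat) : {set L} := [set x : L | x ^+ r == x].

(* Symbols [a,b,c,d] of B(Q_infty), encoded as ((a,b),c),d. *)
Definition elt := (L * L * L * L)%type.
Definition ea (g : elt) : L := g.1.1.1.
Definition eb (g : elt) : L := g.1.1.2.
Definition ec (g : elt) : L := g.1.2.
Definition ed (g : elt) : L := g.2.

Definition Bmem (q m : nat) (g : elt) : bool :=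
  [&& ea g \in Fsub (q ^ 2), ea g != 0, eb g \in Fsub (q ^ 2), ec g \in Fsub (q ^ 2),
      ec g ^+ q + ec g == eb g ^+ q.+1 & ed g ^+ m == ea g].

(* group law: bmul q g' g = g' o g = [a'a, ab'+b, a^{q+1}c'+ab^qb'+c, d'd] *)
Definition bmul (q : nat) (g' g : elt) : elt :=
  (ea g' * ea g, ea g * eb g' + eb g,
   ea g ^+ q.+1 * ec g' + ea g * eb g ^+ q * eb g' + ec g, ed g' * ed g).

Definition bone : elt := (1, 0, 0, 1).

Definition is_subgroupB (q m : nat) (G : {set elt}) : Prop :=
  [/\ {subset G <= Bmem q m}, bone \in G,
      {in G &, forall g h, bmul q g h \in G} &
      {in G, forall g, exists2 h, h \in G & bmul q h g = bone}].

(* the conjugate subgroup h G h^{-1} = { k | k o h = h o g, g in G } *)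
Definition conjB (q : nat) (h : elt) (G : {set elt}) : {set elt} :=
  [set k | [exists g in G, bmul q k h == bmul q h g]].

Definition G0of (G : {set elt}) : {set L} := [set ed g | g in G].
Definition G2of (G : {set elt}) : {set L} := [set eb g | g in G & ea g == 1].
Definition G3of (G : {set elt}) : {set L} :=
  [set ec g | g in G & (ea g == 1) && (eb g == 0)].

Definition is_subfield (K : {set L}) : bool :=
  [&& 0 \in K, 1 \in K &
      [forall x in K, forall y in K, [&& x - y \in K, x * y \in K & x^-1 \in K]]].
Definition genField (S : {set L}) : {set L} :=
  \bigcap_(K : {set L} | is_subfield K && (S \subset K)) K.

Definition vspace_over (K V : {set L}) : Prop :=
  [/\ 0 \in V, {in V &, forall x y, x + y \in V} &
      {in K & V, forall k v, k * v \in V}].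

Definition powset (S : {set L}) (i : nat) : {set L} := [set x ^+ i | x in S].

Definition Wset (p q : nat) (S2 : {set L}) : {set L} :=
  if p == 2%N then [set b ^+ q.+1 | b in S2]
  else [set b1 * b2 ^+ q - b2 * b1 ^+ q | b1 in S2, b2 in S2].

Definition mu (r : nat) : {set L} := [set x : L | x ^+ r == 1].

Definition cyclic_set (S : {set L}) : Prop :=
  exists g : L, S = [set g ^+ (nat_of_ord i) | i : 'I_#|L|].

Definition triple_ok (p q n m : nat) (S0 S2 S3 : {set L}) : Prop :=
  [/\ S0 \subset mu (m * (q ^ 2 - 1)) /\ cyclic_set S0,
      S2 \subset Fsub (q ^ 2) /\ vspace_over (genField (powset S0 m)) S2 &
      [/\ S3 \subset [set c in Fsub (q ^ 2) | c ^+ q + c == 0],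
           vspace_over (genField (powset S0 (q ^ n).+1)) S3 &
           Wset p q S2 \subset S3]].

End Defs.

(* Main.v *)
(* Every subgroup works without conjugation: conjugating by [a,b,c,d] multiplies b by a = d^m
   and c by a^(q+1) = d^(q^n+1), which gives the vector space structures, while commutators
   (squares, if p = 2) of elements of U give W.

   Conversely it suffices to find s : G_2 -> F_{q^2} with s(b)^q + s(b) = b^(q+1) which, modulo
   G_3, satisfies s(b + b') = s(b) + s(b') + b^q b' and s(ab) = a^(q+1) s(b) for a in G_0^m; then
   G = {[d^m,b,c,d] : d in G_0, b in G_2, c - s(b) in G_3}. For p odd take s(b) = b^(q+1)/2. For
   p = 2, modulo G_3 the preimage of G_2 is an elementary abelian 2-group on which G_0^m acts
   with odd order, so Maschke's theorem applies: a section s that need not be equivariant is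
   averaged over the action. *)
Require Import Defs.
From mathcomp Require Import all_boot all_order all_fingroup all_algebra all_solvable all_field.
From mathcomp Require Import ring.
Import GRing.Theory.
Local Open Scope ring_scope.
Set Implicit Arguments. Unset Strict Implicit. Unset Printing Implicit Defensive.

(** * Finite fields: generated subfields, cyclic sets of units, an element of trace one *)

Section Fields.
Variable L : finFieldType.
Implicit Types (S V K : {set L}).

(** As a power, the inverse stays in any set closed under powers; closure under inversion is always
    checked this way below. *)
Lemma invf_card (x : L) : x != 0 -> x^-1 = x ^+ (#|L| - 2).
Proof.
move=> x0; apply: (mulIf x0); rewrite mulVf // -exprSr; apply: (mulIf x0).
have L2 : (1 < #|L|)%N by apply: finNzRing_gt1.
by rewrite mul1r -exprSr -addn2 subnK // expf_card.
Qed.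

Lemma mem_genField S x : x \in S -> x \in genField S.
Proof. by move=> Sx; apply/bigcapP=> K /andP[_ /subsetP]; apply. Qed.

(** The multipliers that map [V] into itself form a subfield, so once they include [S] they include
    [genField S]. *)
Lemma genField_vspace S V :
  0 \in V -> {in V &, forall x y, x + y \in V} ->
  {in S & V, forall x v, x * v \in V} -> vspace_over (genField S) V.
Proof.
move=> V0 VD VM; split=> // x v /bigcapP xK Vv.
pose K := [set y : L | [forall w in V, y * w \in V]].
have KP y : reflect {in V, forall w, y * w \in V} (y \in K).
  by rewrite inE; apply: forall_inP.
have KX y i : y \in K -> y ^+ i \in K.
  move=> /KP Ky; apply/KP=> w Vw; elim: i => [|i IH]; first by rewrite expr0 mul1r.
  by rewrite exprS -mulrA Ky.
(* In characteristic p, [- w] is the sum of p - 1 copies of [w]. *)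
have VN w : w \in V -> - w \in V.
  have [p p_pr pL] := finPcharP L => Vw.
  rewrite -[- w]addr0 -(mulrn_pchar pL w) -(prednK (prime_gt0 p_pr)) mulrSr addrCA addNr addr0.
  by elim: p.-1 => [|i IH]; rewrite ?mulr0n ?mulrS ?VD.
suff sfK : is_subfield K.
  apply/(KP x) => //; apply: xK; rewrite sfK; apply/subsetP=> y Sy.
  by apply/KP=> w; apply: VM.
apply/and3P; split; first by apply/KP=> w _; rewrite mul0r.
  by apply/KP=> w; rewrite mul1r.
apply/forall_inP=> y Ky; apply/forall_inP=> z Kz; apply/and3P; split.
- apply/KP=> w Vw; rewrite mulrBl; apply: VD; first by apply/(KP y).
  by apply: VN; apply/(KP z).
- by apply/KP=> w Vw; rewrite -mulrA; apply/(KP y) => //; apply/(KP z).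
have [->|y0] := eqVneq y 0; first by rewrite invr0; apply/KP=> w _; rewrite mul0r.
by rewrite invf_card // KX.
Qed.

Lemma genField1 S : 1 \in genField S.
Proof. by apply/bigcapP=> K /andP[/and3P[]]. Qed.

Lemma genFieldB S x y : x \in genField S -> y \in genField S -> x - y \in genField S.
Proof.
move=> /bigcapP Sx /bigcapP Sy; apply/bigcapP=> K KS.
case/andP: (KS) => /and3P[_ _ /forall_inP/(_ x (Sx K KS))/forall_inP/(_ y (Sy K KS))].
by case/and3P.
Qed.

Lemma genFieldV S x : x \in genField S -> x^-1 \in genField S.
Proof.
move=> /bigcapP Sx; apply/bigcapP=> K KS.
case/andP: (KS) => /and3P[_ _ /forall_inP/(_ x (Sx K KS))/forall_inP/(_ x (Sx K KS))].
by case/and3P.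
Qed.

Lemma genFieldN1 S : -1 \in genField S.
Proof.
have G1 := genField1 S.
by rewrite -[X in X \in _]add0r -[0](subrr 1) !genFieldB.
Qed.

Lemma genField_half S : 2^-1 \in genField S.
Proof.
apply: genFieldV; have -> : 2 = 1 - -1 :> L by rewrite opprK.
by rewrite genFieldB ?genField1 ?genFieldN1.
Qed.

Lemma vspace_opp S V : vspace_over (genField S) V -> {in V, forall x, - x \in V}.
Proof. by case=> _ _ VM x Vx; rewrite -mulN1r VM ?genFieldN1. Qed.

(** By finiteness [S] is a subgroup of the unit group of a finite field, which is cyclic. *)
Lemma cyclic_set_group S : 1 \in S -> 0 \notin S ->
  {in S &, forall x y, x * y \in S} -> cyclic_set S.
Proof.
move=> S1 S0 SM; pose H := [set u : {unit L} | val u \in S].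
have gH : group_set H.
  by apply/group_setP; split=> [|u v]; rewrite !inE // => Su Sv; apply: SM.
have /cyclicP[g Hg] := field_unit_group_cyclic (Group gH); exists (val g).
apply/setP=> x; apply/idP/imsetP => [Sx|[i _ ->]].
  have x0 : x != 0 by apply: contraNneq S0 => <-.
  have Ux : x \is a GRing.unit by rewrite unitfE.
  have : FinRing.unit L Ux \in H by rewrite inE.
  rewrite [H]Hg => /cyclePmin[i lti E].
  have ltL : (i < #|L|)%N.
    apply: leq_trans lti _; apply: leq_trans (max_card _) _.
    by rewrite -cardsT card_finField_unit leq_pred.
  by exists (Ordinal ltL) => //=; rewrite -FinRing.val_unitX -E.
have : (g ^+ i)%g \in H by rewrite [H]Hg mem_cycle.
by rewrite inE FinRing.val_unitX.
Qed.

(** [cyclic_set] lists only exponents below [#|L|]; since nonzero elements satisfy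
    [g ^+ #|L|.-1 = 1], all exponents are covered. The roots of unity serve to exclude [g = 0]. *)
Lemma cyclic_setX S r : (0 < r)%N -> S \subset mu L r -> cyclic_set S ->
  exists g : L, [/\ g != 0, forall i, g ^+ i \in S & forall x, x \in S -> exists i, x = g ^+ i].
Proof.
move=> r0 sS [g Sg]; have L1 : (1 < #|L|)%N by apply: finNzRing_gt1.
have g0 : g != 0.
  have : g \in mu L r.
    by apply: (subsetP sS); rewrite Sg; apply/imsetP; exists (Ordinal L1).
  by rewrite inE; apply: contraTneq => ->; rewrite expr0n eqn0Ngt r0 /= eq_sym oner_eq0.
exists g; split=> // [i|x]; last by rewrite Sg => /imsetP[i _ ->]; exists i.
have gN : g ^+ #|L|.-1 = 1.
  by apply: (mulIf g0); rewrite mul1r -exprSr prednK ?expf_card // ltnW.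
have N0 : (0 < #|L|.-1)%N by rewrite -ltnS prednK // ltnW.
have lti : (i %% #|L|.-1 < #|L|)%N.
  by apply: leq_trans (ltn_pmod _ N0) (leq_pred _).
rewrite Sg; apply/imsetP; exists (Ordinal lti) => //=.
by rewrite {1}(divn_eq i #|L|.-1) exprD mulnC exprM gN expr1n mul1r.
Qed.

(** For u in F_{q^2} outside F_q, the trace u^q + u is a nonzero element of F_q, and dividing u by
    it gives trace one. *)
Lemma trace_one (q n : nat) : 2%N \in [pchar L] -> [pchar L].-nat q -> (1 < q)%N -> (0 < n)%N ->
  #|L| = (q ^ (2 * n))%N -> exists2 e : L, e \in Fsub L (q ^ 2) & e ^+ q + e = 1.
Proof.
move=> L2 Lq q1 n0 cardL.
have q2 : (1 < q ^ 2)%N by rewrite -{1}(exp1n 2) ltn_exp2r.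
suff [u u2 uq] : exists2 u : L, u ^+ (q ^ 2) = u & u ^+ q != u.
  have t0 : u ^+ q + u != 0 by rewrite addr_eq0 oppr_pchar2.
  have tq : (u ^+ q + u) ^+ q = u ^+ q + u.
    by rewrite exprDn_pchar // -exprM mulnn u2 addrC.
  exists (u / (u ^+ q + u)); first by rewrite inE exprMn exprVn u2 -mulnn [X in _ / X]exprM !tq.
  by rewrite exprMn exprVn tq -mulrDl mulfV.
have /cyclicP[g Lg] := field_unit_group_cyclic [set: {unit L}].
have og : #[g]%g = (q ^ (2 * n)).-1 by rewrite orderE -Lg card_finField_unit cardL.
have [M ME] : exists M, (q ^ (2 * n)).-1 = (M * (q ^ 2).-1)%N.
  by apply/dvdnP; rewrite expnM dvdn_pred_predX.
have gM : (g ^+ (M * (q ^ 2).-1) = 1)%g by rewrite -ME -og expg_order.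
(* For a generator [g] of the unit group, [g ^+ M] has order q^2 - 1, too large for an element of
   F_q. *)
exists (val (g ^+ M)%g).
  rewrite -FinRing.val_unitX -expgM -(prednK (ltnW q2)) mulnS expgD gM mulg1 //.
apply/eqP=> /(congr1 (fun x => x / val (g ^+ M)%g)).
rewrite divff -?unitfE ?(valP (g ^+ M)%g) // -[in X in X / _](prednK (ltnW q1)) exprSr mulfK; last first.
  by rewrite -unitfE (valP (g ^+ M)%g).
rewrite -FinRing.val_unitX -expgM => E.
have : (#[g]%g %| M * q.-1)%N by rewrite order_dvdn; apply/eqP/val_inj; rewrite E.
have M0 : (0 < M)%N.
  rewrite lt0n; apply/eqP=> M0; move: ME; rewrite M0 mul0n; apply/eqP.
  by rewrite -lt0n -ltnS prednK ?expn_gt0 ?(ltnW q1) // -{1}(exp1n (2 * n)) ltn_exp2r ?muln_gt0.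
rewrite og ME dvdn_pmul2l // => /dvdn_leq; rewrite -ltnS prednK ?(ltnW q1) // q1 => /(_ isT).
by rewrite -ltnS !prednK ?(ltnW q1) ?(ltnW q2) // leqNgt -{1}(expn1 q) ltn_exp2l.
Qed.

End Fields.

(** * Sections s of the projection to b, and the subgroup built from a section *)

Section Converse.
Variable L : finFieldType.
Variable q : nat.
Hypothesis Lq : [pchar L].-nat q.
Implicit Types (S V : {set L}) (s : L -> L).

Definition splits_trace s S :=
  {in S, forall b, s b \in Fsub L (q ^ 2) /\ s b ^+ q + s b = b ^+ q.+1}.

(** This is the condition that b -> [1,b,s(b)] be multiplicative modulo the elements [1,0,c] with c
    in [V]. *)
Definition cocycle_mod s S V :=
  {in S &, forall b b', s (b + b') - s b - s b' - b ^+ q * b' \in V}.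

Let frobD (x y : L) : (x + y) ^+ q = x ^+ q + y ^+ q.
Proof. exact: exprDn_pchar. Qed.

Let FsubD (x y : L) : x \in Fsub L (q ^ 2) -> y \in Fsub L (q ^ 2) -> x + y \in Fsub L (q ^ 2).
Proof.
rewrite !inE => /eqP Ex /eqP Ey.
by rewrite exprDn_pchar ?Ex ?Ey // pnatX Lq.
Qed.

Let FsubM (x y : L) : x \in Fsub L (q ^ 2) -> y \in Fsub L (q ^ 2) -> x * y \in Fsub L (q ^ 2).
Proof. by rewrite !inE exprMn => /eqP-> /eqP->. Qed.

Let FsubX (x : L) i : x \in Fsub L (q ^ 2) -> x ^+ i \in Fsub L (q ^ 2).
Proof. by rewrite !inE -exprM mulnC exprM => /eqP->. Qed.

Let normF (b : L) : b \in Fsub L (q ^ 2) -> (b ^+ q.+1) ^+ q = b ^+ q.+1.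
Proof. by rewrite inE => /eqP b2; rewrite exprS exprMn -exprM mulnn b2 mulrC. Qed.

Lemma Fsub_pow m d : d \in mu L (m * (q ^ 2 - 1)) -> d ^+ m \in Fsub L (q ^ 2).
Proof.
have q0 : (0 < q)%N by case/andP: Lq.
rewrite !inE exprM => /eqP E.
by rewrite -[X in _ ^+ X == _](@subnK 1) ?expn_gt0 ?q0 // exprD E mul1r.
Qed.

(** The norm b^(q+1) lies in F_q, so half of it has trace b^(q+1). The failure of additivity is half
    a generator of W. *)
Lemma odd_section S V : 2 != 0 :> L -> S \subset Fsub L (q ^ 2) ->
  {in S &, forall b1 b2, 2^-1 * (b1 * b2 ^+ q - b2 * b1 ^+ q) \in V} ->
  let s b := 2^-1 * b ^+ q.+1 in splits_trace s S /\ cocycle_mod s S V.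
Proof.
move=> two0 SF W s; split=> [b Sb | b b' Sb Sb'].
  have Fb := subsetP SF b Sb.
  have E : (2^-1 : L) ^+ q = 2^-1.
    rewrite exprVn; congr _^-1; have -> : 2 = 1 + 1 :> L by [].
    by rewrite frobD expr1n.
  split; first by rewrite FsubM ?FsubX // inE exprM !E.
  rewrite /s exprMn E normF // -mulrDr -mulr2n -[X in _ * X]mulr_natl mulrA mulVf //.
  by rewrite mul1r.
suff -> : s (b + b') - s b - s b' - b ^+ q * b' = 2^-1 * (b * b' ^+ q - b' * b ^+ q) by apply: W.
rewrite /s !exprS frobD; move: (b ^+ q) (b' ^+ q) => u v; by field.
Qed.

(* The section is read off a maximal subgroup of pairs (b,c) lying over S that meets b = 0 in V:
   if b were missing from its projection, the pair (b, e b^(q+1)) could be adjoined, because its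
   square and its commutators lie in V. *)
Lemma even_section S V (e : L) : 2%N \in [pchar L] ->
  e \in Fsub L (q ^ 2) -> e ^+ q + e = 1 ->
  S \subset Fsub L (q ^ 2) -> 0 \in S -> {in S &, forall x y, x + y \in S} ->
  V \subset [set c in Fsub L (q ^ 2) | c ^+ q + c == 0] ->
  0 \in V -> {in V &, forall x y, x + y \in V} -> {in S, forall b, b ^+ q.+1 \in V} ->
  exists s, splits_trace s S /\ cocycle_mod s S V.
Proof.
move=> L2 Fe e1 SF S0 SD VF V0 VD W.
have EE (x : L) : x + x = 0 by rewrite addrr_pchar2.
have q0 : (0 < q)%N by case/andP: Lq.
(* On the coordinates (b,c) of U, [mul u v] is the product v o u. *)
pose mul (u v : L * L) := (u.1 + v.1, u.2 + v.2 + u.1 ^+ q * v.1).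
pose P (U : {set L * L}) := [&& [forall c in V, (0, c) \in U],
  [forall u in U, [&& u.1 \in S, u.2 \in Fsub L (q ^ 2) & u.2 ^+ q + u.2 == u.1 ^+ q.+1]],
  [forall u in U, forall v in U, mul u v \in U] &
  [forall u in U, (u.1 == 0) ==> (u.2 \in V)]].
have : P [set u | (u.1 == 0) && (u.2 \in V)].
  apply/and4P; split.
  - by apply/forall_inP=> c Vc; rewrite inE eqxx.
  - apply/forall_inP=> -[b c] /=; rewrite inE /= => /andP[/eqP-> Vc].
    by have := subsetP VF c Vc; rewrite inE S0 => /andP[-> /eqP->]; rewrite expr0n eqxx.
  - apply/forall_inP=> -[b c]; rewrite inE => /andP[/= /eqP-> Vc].
    apply/forall_inP=> -[b' c']; rewrite inE => /andP[/= /eqP-> Vc'].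
    by rewrite inE /= addr0 mulr0 addr0 eqxx VD.
  - by apply/forall_inP=> -[b c]; rewrite inE => /andP[/= -> ->].
case/maxset_exists=> U /maxsetP[/and4P[/forall_inP UV /forall_inP US /forall_inP UM /forall_inP UK] Umax] _.
have {}UM u v : u \in U -> v \in U -> mul u v \in U by move=> Uu /(forall_inP (UM u Uu)).
have {}US u : u \in U -> [/\ u.1 \in S, u.2 \in Fsub L (q ^ 2) & u.2 ^+ q + u.2 = u.1 ^+ q.+1].
  by move=> /US/and3P[? ? /eqP].
have {}UK c : (0, c) \in U -> c \in V by move=> /UK; rewrite eqxx.
(* The commutator pairing is the polarization of the norm b^(q+1), whose values on [S] lie in
   [V]. *)
have comm u v : u \in S -> v \in S -> u ^+ q * v + v ^+ q * u \in V.
  move=> Su Sv; have -> : u ^+ q * v + v ^+ q * u = (u + v) ^+ q.+1 + u ^+ q.+1 + v ^+ q.+1.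
    rewrite !exprS frobD; move: (u ^+ q) (v ^+ q) => x y.
    transitivity (x * v + y * u + (u * x + u * x) + (v * y + v * y)); last by ring.
    by rewrite !EE !addr0.
  by rewrite !VD ?W ?SD.
have UT b c t : (b, c) \in U -> t \in V -> (b, c + t) \in U.
  by move=> Uu Vt; have := UM _ _ Uu (UV t Vt); rewrite /mul /= mulr0 !addr0.
have full b : b \in S -> exists c, (b, c) \in U.
  move=> Sb; case: (boolP [exists u in U, u.1 == b]).
    by case/exists_inP=> -[b' c] Uc /= /eqP <-; exists c.
  move=> nb; pose w : L * L := (b, e * b ^+ q.+1).
  have Fb := subsetP SF b Sb.
  pose U' := U :|: [set mul u w | u in U].
  have memw u : u \in U -> mul u w \in U' by move=> Uu; rewrite inE (imset_f (mul^~ w)) ?orbT.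
  have sUU' : U \subset U' by apply: subsetUl.
  have PU' : P U'.
    apply/and4P; split.
    - by apply/forall_inP=> c /UV; apply: (subsetP sUU').
    - apply/forall_inP=> u; rewrite inE => /orP[/US[-> -> ->]|/imsetP[[x y] /US[/= Sx Fy Ey] ->]].
        by rewrite eqxx.
      have Fx := subsetP SF x Sx.
      rewrite /= SD // !FsubD ?FsubM ?FsubX //=; apply/eqP.
      rewrite !frobD !exprMn normF // -[(x ^+ q) ^+ q]exprM mulnn.
      move: Fx; rewrite inE => /eqP ->.
      have -> : e ^+ q = 1 + e by rewrite -e1 -addrA EE addr0.
      transitivity (y ^+ q + y + b ^+ q.+1 + (e * b ^+ q.+1 + e * b ^+ q.+1) + x * b ^+ q + x ^+ q * b).
        by ring.
      rewrite Ey EE addr0 !exprS frobD; move: (x ^+ q) (b ^+ q) => X B; ring.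
    - apply/forall_inP=> u; rewrite inE => Uu; apply/forall_inP=> v; rewrite inE => Uv.
      case/orP: Uu Uv => [Uu|/imsetP[[x y] Uxy ->]] /orP[Uv|/imsetP[[x' y'] Uxy' ->]].
      + by apply: (subsetP sUU'); apply: UM.
      + have -> : mul u (mul (x', y') w) = mul (mul u (x', y')) w.
          by rewrite /mul /= frobD; congr (_, _); ring.
        by apply/memw/UM.
      + case: v Uv => x' y' Uv.
        (* Moving [w] past the second factor costs a commutator, which [UT] absorbs into [U]. *)
        have [[/= Sx _ _] [/= Sx' _ _]] := (US _ Uxy, US _ Uv).
        have := UT _ _ _ (UM _ _ Uxy Uv) (comm _ _ Sb Sx') => /memw.
        suff -> : mul (mul (x, y) w) (x', y') =
          mul (x + x', y + y' + x ^+ q * x' + (b ^+ q * x' + x' ^+ q * b)) w by [].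
        rewrite /mul /= !frobD; congr (_, _); first by ring.
        rewrite -[LHS]addr0 -(EE (x' ^+ q * b)); ring.
      (* The square of [w] is (0, b^(q+1)), with second entry in [V]; hence one extra coset is
         enough. *)
      + apply: (subsetP sUU').
        have [[/= Sx _ _] [/= Sx' _ _]] := (US _ Uxy, US _ Uxy').
        have := UT _ _ _ (UM _ _ Uxy Uxy') (VD _ _ (comm _ _ Sb Sx') (W b Sb)).
        suff -> : mul (mul (x, y) w) (mul (x', y') w) =
          (x + x', y + y' + x ^+ q * x' + (b ^+ q * x' + x' ^+ q * b + b ^+ q.+1)) by [].
        rewrite /mul /= !frobD; congr (_, _); first by rewrite addrACA EE addr0.
        rewrite -[RHS]addr0 -(EE (e * b ^+ q.+1 + x ^+ q * b)) !exprS; ring.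
    - apply/forall_inP=> u; rewrite inE => /orP[|/imsetP[[x y] Uxy ->]].
        by case: u => x y Uxy; apply/implyP=> /= /eqP x0; apply: UK; rewrite -x0.
      apply/implyP=> /=; rewrite addr_eq0 oppr_pchar2 // => /eqP xb.
      by case/negP: nb; apply/exists_inP; exists (x, y) => //=; rewrite xb.
  exists (e * b ^+ q.+1); rewrite -(Umax _ PU' sUU').
  have := memw _ (UV 0 V0); rewrite /mul /= !add0r expr0n.
  by rewrite eqn0Ngt q0 mul0r addr0.
(* The product of the two pairs is (0, c + c' + b^(q+1)), and the norm is already in [V]. *)
have uniqU b c c' : (b, c) \in U -> (b, c') \in U -> c + c' \in V.
  move=> Uc Uc'; have [/= Sb _ _] := US _ Uc.
  have := UM _ _ Uc Uc'; rewrite /mul /= EE => /UK Vc.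
  have := VD _ _ Vc (W b Sb); suff -> : c + c' + b ^+ q * b + b ^+ q.+1 = c + c' by [].
  by rewrite exprSr -addrA EE addr0.
pose s b := odflt 0 [pick c | (b, c) \in U].
have sU b : b \in S -> (b, s b) \in U.
  by rewrite /s; case: pickP => // nb /full[c]; rewrite nb.
exists s; split=> [b /sU/US[] // | b b' Sb Sb'].
have := uniqU _ _ _ (sU _ (SD _ _ Sb Sb')) (UM _ _ (sU _ Sb) (sU _ Sb')).
by rewrite !oppr_pchar2 // !addrA.
Qed.


(** Each twist b -> a^(-i(q+1)) s(a^i b) is again a section. As N = 1 in L, summing N of them is
    already an average, without division. Equivariance of the result is exact, not only modulo
    [V]. *)
Lemma equivariant_average S V s (a : L) N :
  a != 0 -> a \in Fsub L (q ^ 2) -> a ^+ N = 1 -> N%:R = 1 :> L ->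
  {in S, forall b, a * b \in S} ->
  0 \in V -> {in V &, forall x y, x + y \in V} -> {in V, forall c, (a ^+ q.+1)^-1 * c \in V} ->
  splits_trace s S -> cocycle_mod s S V ->
  exists s', [/\ splits_trace s' S, cocycle_mod s' S V &
                 forall i b, s' (a ^+ i * b) = (a ^+ i) ^+ q.+1 * s' b].
Proof.
move=> a0 Fa aN N1 Sa V0 VD Va sT sC.
have q0 : (0 < q)%N by case/andP: Lq.
set k := (a ^+ q.+1)^-1 in Va.
have Sai i b : b \in S -> a ^+ i * b \in S.
  by move=> Sb; elim: i => [|i IH]; rewrite ?mul1r // exprS -mulrA Sa.
have Vki i c : c \in V -> k ^+ i * c \in V.
  by move=> Vc; elim: i => [|i IH]; rewrite ?mul1r // exprS -mulrA Va.
have ka i : k ^+ i * (a ^+ i) ^+ q.+1 = 1.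
  by rewrite -exprM mulnC exprM -exprMn mulVf ?expf_neq0 // expr1n.
have kq i : (k ^+ i) ^+ q = k ^+ i by rewrite -exprM mulnC exprM exprVn normF.
(* The powers of [k] are inverse norms, hence fixed by the q-th power map, and multiplying by them
   commutes with the trace. *)
have Fk i : k ^+ i \in Fsub L (q ^ 2) by rewrite inE -mulnn exprM !kq.
have sumN (c : L) : \sum_(i < N) c = c by rewrite sumr_const card_ord -mulr_natl N1 mul1r.
pose s' b := \sum_(i < N) k ^+ i * s (a ^+ i * b).
exists s'; split.
- move=> b Sb; split.
    rewrite /s'; elim/big_rec: _ => [|i x _ Fx]; first by rewrite inE expr0n expn_eq0 eqn0Ngt q0.
    by rewrite FsubD // FsubM //; case: (sT _ (Sai i b Sb)).
  have -> : s' b ^+ q = \sum_(i < N) (k ^+ i * s (a ^+ i * b)) ^+ q.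
    by apply: (big_morph (fun x : L => x ^+ q)) => //; rewrite expr0n eqn0Ngt q0.
  rewrite -big_split -[RHS]sumN; apply: eq_bigr => i _ /=.
  by rewrite exprMn kq -mulrDr; case: (sT _ (Sai i b Sb)) => _ ->; rewrite exprMn mulrA ka mul1r.
- move=> b b' Sb Sb'; rewrite -[b ^+ q * b']sumN /s' -!sumrB.
  elim/big_rec: _ => // i x _ Vx; apply: VD => //.
  rewrite mulrDr -!mulrBr -[b ^+ q * b']mul1r -(ka i).
  have := Vki i _ (sC _ _ (Sai i b Sb) (Sai i b' Sb')).
  rewrite exprMn !exprSr; congr (_ \in V); ring.
elim=> [|i IH] b; first by rewrite !expr0 expr1n !mul1r.
suff sa c : s' (a * c) = a ^+ q.+1 * s' c.
  by rewrite exprS -mulrA sa IH mulrA -exprMn.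
(* Replacing c by a c shifts the index by one; the shifted sum is unchanged because F N = F 0. *)
pose F i := k ^+ i * s (a ^+ i * c).
transitivity (a ^+ q.+1 * \sum_(i < N) F i.+1).
  rewrite mulr_sumr; apply: eq_bigr => j _; rewrite /F [k ^+ j.+1]exprS [a ^+ j.+1]exprSr !mulrA.
  by rewrite mulfV ?expf_neq0 // mul1r.
congr (_ * _); apply: (addrI (F 0)).
rewrite -[F 0 + _](big_ord_recl N (fun i => F (nat_of_ord i))) /= big_ord_recr addrC; congr (_ + _).
by rewrite /F aN [k ^+ N]exprVn -exprM mulnC exprM aN expr1n invr1 !expr0.
Qed.

(** In a product of two elements of the set [G], the deviation of the third coordinate from s is a
    sum of a cocycle defect, an equivariance defect and elements of [S3]. *)
Lemma section_subgroup m S0 S2 S3 s :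
  S0 \subset mu L (m * (q ^ 2 - 1)) -> 1 \in S0 -> 0 \notin S0 ->
  {in S0 &, forall x y, x * y \in S0} -> {in S0, forall x, x^-1 \in S0} ->
  S2 \subset Fsub L (q ^ 2) -> vspace_over (genField (powset S0 m)) S2 ->
  S3 \subset [set c in Fsub L (q ^ 2) | c ^+ q + c == 0] ->
  vspace_over (genField (powset S0 (m * q.+1))) S3 ->
  splits_trace s S2 -> cocycle_mod s S2 S3 ->
  {in S0 & S2, forall d b, s (d ^+ m * b) - (d ^+ m) ^+ q.+1 * s b \in S3} ->
  exists G : {set elt L},
    [/\ is_subgroupB q m G, G0of G = S0, G2of G = S2 & G3of G = S3].
Proof.
move=> S0mu S01 S00 S0M S0V S2F S2K S3F S3K sT sC sE.
have q0 : (0 < q)%N by case/andP: Lq.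
have [S20 S2D _] := S2K; have [S30 S3D _] := S3K.
have S2M d b : d \in S0 -> b \in S2 -> d ^+ m * b \in S2.
  by move=> Sd Sb; case: S2K => _ _; apply=> //; apply/mem_genField/imset_f.
have S3M d c : d \in S0 -> c \in S3 -> (d ^+ m) ^+ q.+1 * c \in S3.
  by move=> Sd Sc; case: S3K => _ _; apply=> //; rewrite -exprM; apply/mem_genField/imset_f.
have S3N := vspace_opp S3K; have S2N := vspace_opp S2K.
have s0 : s 0 \in S3.
  have := sC 0 0 S20 S20; rewrite mulr0 addr0 subrr sub0r subr0 => /S3N.
  by rewrite opprK.
pose G : {set elt L} :=
  [set g | [&& ed g \in S0, ea g == ed g ^+ m, eb g \in S2 & ec g - s (eb g) \in S3]].
have GP d b c : d \in S0 -> b \in S2 -> c - s b \in S3 -> (d ^+ m, b, c, d) \in G.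
  by move=> ? ? ?; rewrite inE; apply/and4P.
have GE g : g \in G -> exists d b c, [/\ g = (d ^+ m, b, c, d), d \in S0, b \in S2 & c - s b \in S3].
  case: g => [[[a b] c] d]; rewrite inE => /and4P[Sd /eqP Ea Sb Sc]; exists d, b, c.
  by split=> //; congr (_, _, _, _).
exists G; split.
- split.
  + move=> _ /GE[d [b [c [-> Sd Sb Sc]]]].
    have d0 : d != 0 by apply: contraNneq S00 => <-.
    have [Fs sq] := sT _ Sb; have := subsetP S3F _ Sc; rewrite inE => /andP[Fc /eqP cq].
    have Fa := Fsub_pow (subsetP S0mu _ Sd).
    have cE : c = (c - s b) + s b by rewrite subrK.
    rewrite unfold_in /Bmem /ea /eb /ec /ed /= eqxx expf_neq0 // Fa (subsetP S2F _ Sb) //=.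
    by rewrite cE FsubD // frobD addrACA cq sq add0r eqxx.
  + have := GP 1 0 0 S01 S20; rewrite expr1n; apply; rewrite sub0r; exact: S3N.
  + move=> _ _ /GE[d' [b' [c' [-> Sd' Sb' Sc']]]] /GE[d [b [c [-> Sd Sb Sc]]]].
    rewrite /bmul /= /ea /eb /ec /ed /= -exprMn; apply: GP; rewrite ?S0M ?S2D ?S2M //.
    have /S3N H1 := sC _ _ Sb (S2M d b' Sd Sb'); have /S3N H2 := sE d b' Sd Sb'.
    have := S3D _ _ (S3D _ _ (S3M d _ Sd Sc') Sc) (S3D _ _ H1 H2).
    by rewrite [_ + b]addrC; congr (_ \in S3); ring.
  + move=> _ /GE[d [b [c [-> Sd Sb Sc]]]].
    have d0 : d != 0 by apply: contraNneq S00 => <-.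
    have a0 : d ^+ m != 0 by rewrite expf_neq0.
    have aV : d^-1 ^+ m * d ^+ m = 1 by rewrite exprVn mulVf.
    (* With a = d^m, these solve a bh + b = 0 and a^(q+1) ch + a b^q bh + c = 0. *)
    pose bh := - (d^-1 ^+ m * b); pose ch := (d^-1 ^+ m) ^+ q.+1 * (b ^+ q.+1 - c).
    have Sbh : bh \in S2 by rewrite S2N // S2M // S0V.
    have abh : d ^+ m * bh = - b by rewrite /bh mulrN mulrA [_ * _^-1 ^+ _]mulrC aV mul1r.
    exists (d^-1 ^+ m, bh, ch, d^-1).
      apply: GP => //; first exact: S0V.
      (* Since d^m bh = -b, [H1] compares s(bh) with s(-b), and [H2] compares s(-b) with s(b). *)
      have H1 := sE d bh Sd Sbh; have H2 := sC b (- b) Sb (S2N _ Sb).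
      have := S3D _ _ (S3D _ _ H2 (S3N _ s0)) (S3D _ _ (S3N _ Sc) H1).
      move/(S3M _ _ (S0V _ Sd)); congr (_ \in S3).
      have sE' : s bh = (d^-1 ^+ m) ^+ q.+1 * ((d ^+ m) ^+ q.+1 * s bh).
        by rewrite mulrA -exprMn aV expr1n mul1r.
      by rewrite abh subrr /ch [in RHS]sE' [b ^+ _.+1]exprSr; ring.
    rewrite /bmul /bone /= /ea /eb /ec /ed /= abh aV addNr mulVf //; congr (_, _, _, _).
    rewrite mulrAC abh /ch mulrA -exprMn [_ ^+ m * _]mulrC aV expr1n.
    by rewrite exprSr; ring.
- apply/setP=> d; apply/imsetP/idP=> [[_ /GE[d' [b [c [-> Sd _ _]]]] ->] //|Sd].
  by exists (d ^+ m, 0, 0, d) => //; apply: GP; rewrite // sub0r S3N.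
- apply/setP=> b; apply/imsetP/idP=> [[g]|Sb].
    by rewrite inE => /andP[/GE[d [b' [c [-> _ Sb _]]]] _] ->.
  exists (1 ^+ m, b, s b, 1) => //.
  by rewrite inE GP ?subrr //= /ea /= expr1n.
- apply/setP=> c; apply/imsetP/idP=> [[g]|Sc].
    rewrite inE => /and3P[/GE[d [b' [c' [-> _ Sb Sc]]]] _ /=].
    rewrite /eb /ec /= => /eqP b0 ->; move: Sc; rewrite b0 => /S3D/(_ s0).
    by rewrite subrK.
  exists (1 ^+ m, 0, c, 1) => //.
  by rewrite inE GP /ea /eb /= ?expr1n ?eqxx //; apply: S3D => //; apply: S3N.
Qed.

End Converse.

Lemma dvdn_expS_odd q n : odd n -> (q.+1 %| (q ^ n).+1)%N.
Proof.
move=> n_odd; rewrite -[n]odd_double_half n_odd add1n.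
case: q => [|q]; first by rewrite dvd1n.
elim: n./2 => [|i IH]; first by rewrite expn1.
(* With Q = q + 1 and j odd: (Q^(j+2) + 1) + (Q^2 - 1) = Q^2 (Q^j + 1), where Q + 1 divides Q^2 -
   1. *)
have E : ((q.+1 ^ i.+1.*2.+1).+1 + q * q.+2 = q.+1 ^ 2 * (q.+1 ^ i.*2.+1).+1 :> nat)%N.
  by rewrite doubleS -[i.*2.+3]add2n expnD; move: (q.+1 ^ i.*2.+1)%N => x; ring.
by rewrite -(dvdn_addl _ (dvdn_mull q (dvdnn q.+2))) E dvdn_mull.
Qed.

(** * The triple of a given subgroup *)

Section Forward.
Variable L : finFieldType.
Implicit Types G : {set elt L}.

Lemma bone_Bmem q m : (0 < q)%N -> Bmem q m (bone L).
Proof.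
move=> q0; rewrite /Bmem /bone /ea /eb /ec /ed /= !inE !expr1n !expr0n !expn_eq0 !eqn0Ngt q0 /=.
by rewrite !eqxx oner_eq0 addr0 eqxx.
Qed.

Lemma conjB_bone q G : (0 < q)%N -> conjB q (bone L) G = G.
Proof.
move=> q0.
have B1 k : bmul q k (bone L) = k.
  case: k => [[[a b] c] d]; rewrite /bmul /ea /eb /ec /ed /= !expr1n expr0n eqn0Ngt q0 /=.
  by rewrite !mulr1 !mulr0 !mul1r mul0r !addr0.
have B2 k : bmul q (bone L) k = k.
  case: k => [[[a b] c] d]; rewrite /bmul /ea /eb /ec /ed /=.
  by rewrite !mulr0 !mul1r !add0r.
apply/setP=> k; rewrite inE B1; apply/exists_inP/idP=> [[g Gg]|Gk].
  by rewrite B2 => /eqP->.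
by exists k; rewrite ?B2.
Qed.

Lemma subgroup_triple p q n m G : p \in [pchar L] -> (0 < q)%N -> (0 < m)%N ->
  (m * q.+1)%N = (q ^ n).+1 -> is_subgroupB q m G ->
  triple_ok p q n m (G0of G) (G2of G) (G3of G).
Proof.
move=> Lp q0 m0 mE [GB G1 GM GV].
have GP a b c d : (a, b, c, d) \in G -> [/\ a \in Fsub L (q ^ 2), a != 0, b \in Fsub L (q ^ 2),
    c \in Fsub L (q ^ 2) & c ^+ q + c = b ^+ q.+1 /\ d ^+ m = a].
  by move=> /GB; rewrite unfold_in => /and5P[? ? ? ? /andP[/eqP ? /eqP ?]].
have G0P d : reflect (exists a b c, (a, b, c, d) \in G) (d \in G0of G).
  apply: (iffP imsetP) => [[[[[a b] c] d'] Gg ->]|[a [b [c Gg]]]]; first by exists a, b, c.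
  by exists (a, b, c, d).
have G2P b : reflect (exists c d, (1, b, c, d) \in G) (b \in G2of G).
  apply: (iffP imsetP) => [[[[[a b'] c] d']]|[c [d Gg]]].
    by rewrite inE => /andP[Gg /eqP /= a1] ->; rewrite -a1; exists c, d'.
  by exists (1, b, c, d); rewrite // inE Gg /ea /=.
have G3P c : reflect (exists d, (1, 0, c, d) \in G) (c \in G3of G).
  apply: (iffP imsetP) => [[[[[a b'] c'] d']]|[d Gg]].
    rewrite inE => /and3P[Gg /eqP]; rewrite /ea /eb /ec /= => a1 /eqP b0 ->.
    by exists d'; rewrite -a1 -[X in (_, X, _, _)]b0.
  by exists (1, 0, c, d); rewrite // inE Gg /ea /eb /= !eqxx.
have {}GM a b c d a' b' c' d' : (a', b', c', d') \in G -> (a, b, c, d) \in G ->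
  (a' * a, a * b' + b, a ^+ q.+1 * c' + a * b ^+ q * b' + c, d' * d) \in G.
  by move=> Gg' Gg; apply: (GM _ _ Gg' Gg).
have {}GV a b c d : (a, b, c, d) \in G -> exists a' b' c' d', [/\ (a', b', c', d') \in G,
   a' * a = 1, a * b' + b = 0, a ^+ q.+1 * c' + a * b ^+ q * b' + c = 0 & d' * d = 1].
  move=> /GV[[[[a' b'] c'] d'] Gg' [E1 E2 E3 E4]].
  by exists a', b', c', d'.
split.
- split.
    apply/subsetP=> d /G0P[a [b [c /GP[]]]]; rewrite !inE => /eqP aq a0 _ _ [_ da].
    rewrite exprM da; apply/eqP/(mulIf a0).
    by rewrite mul1r -exprSr -addn1 subnK ?expn_gt0 ?q0.
  apply: cyclic_set_group.
  + by apply/G0P; exists 1, 0, 0.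
  + apply/G0P=> -[a [b [c /GP[_ a0 _ _ [_ E]]]]].
    by move: a0; rewrite -E expr0n eqn0Ngt m0 eqxx.
  + move=> d' d /G0P[a' [b' [c' Gg']]] /G0P[a [b [c Gg]]].
    by apply/G0P; do 3!eexists; apply: GM Gg' Gg.
- split; first by apply/subsetP=> b /G2P[c [d /GP[]]].
  apply: genField_vspace.
  + by apply/G2P; exists 0, 1.
  + move=> b' b /G2P[c' [d' Gg']] /G2P[c [d Gg]]; apply/G2P; do 2!eexists.
    by have := GM _ _ _ _ _ _ _ _ Gg' Gg; rewrite !mul1r; apply.
  + move=> _ b' /imsetP[d /G0P[a [b [c Gg]]] ->] /G2P[c' [d' Gu]].
    have [_ _ _ _ [_ ->]] := GP _ _ _ _ Gg.
    (* For u = [1,b',c',d'] and g = [a,b,c,d], the conjugate g^(-1) o u o g has first entry 1 and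
       second entry a b' = d^m b'. *)
    have [ah [bh [ch [dh [Gh aE bE _ _]]]]] := GV _ _ _ _ Gg.
    have := GM _ _ _ _ _ _ _ _ Gh (GM _ _ _ _ _ _ _ _ Gu Gg); rewrite mul1r aE addrCA bE addr0 => H.
    by apply/G2P; do 2!eexists; apply: H.
- split.
  + apply/subsetP=> c /G3P[d /GP[_ _ _ Fc [Ec _]]].
    by rewrite inE Fc Ec expr0n /=.
  + apply: genField_vspace.
    * by apply/G3P; exists 1.
    * move=> c' c /G3P[d' Gg'] /G3P[d Gg]; apply/G3P; eexists.
      by have := GM _ _ _ _ _ _ _ _ Gg' Gg; rewrite expr1n !mul1r addr0 mulr0 addr0; apply.
    move=> _ c' /imsetP[d /G0P[a [b [c Gg]]] ->] /G3P[d' Gu].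
    have [_ _ _ _ [_ da]] := GP _ _ _ _ Gg.
    (* The same conjugation at b' = 0 multiplies c' by a^(q+1) = d^(m(q+1)) = d^(q^n+1). *)
    have [ah [bh [ch [dh [Gh aE bE cE _]]]]] := GV _ _ _ _ Gg.
    have := GM _ _ _ _ _ _ _ _ Gh (GM _ _ _ _ _ _ _ _ Gu Gg).
    rewrite mul1r aE !mulr0 add0r addr0 bE addrCA cE addr0 -da -[d ^+ m ^+ _]exprM mE => H.
    by apply/G3P; eexists; apply: H.
  rewrite /Wset; case: (eqVneq p 2%N) => [p2|_].
    apply/subsetP=> _ /imsetP[b /G2P[c [d Gg]] ->]; rewrite p2 in Lp.
    (* In characteristic 2 the square of [1,b,c,d] has entries 1, 0 and b^(q+1). *)
    have := GM _ _ _ _ _ _ _ _ Gg Gg; rewrite !mul1r expr1n mul1r -exprSr addrAC.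
    by rewrite !addrr_pchar2 // add0r => H; apply/G3P; eexists; apply: H.
  apply/subsetP=> _ /imset2P[b1 b2 /G2P[c1 [d1 Gu]] /G2P[c2 [d2 Gv]] ->].
  (* The commutator (v o u)^(-1) o (u o v) has b-entry 0; its c-entry is the difference of those of
     u o v and v o u. *)
  have G21 := GM _ _ _ _ _ _ _ _ Gv Gu; have G12 := GM _ _ _ _ _ _ _ _ Gu Gv.
  have [ah [bh [ch [dh [Gh aE bE cE _]]]]] := GV _ _ _ _ G21.
  have := GM _ _ _ _ _ _ _ _ Gh G12; move: aE bE cE.
  rewrite !mul1r !expr1n !mul1r !mulr1 => -> bE cE H.
  apply/G3P; eexists; move: H; rewrite [b1 + b2]addrC bE.
  set x := (X in (_, _, X, _)); suff -> : x = b1 * b2 ^+ q - b2 * b1 ^+ q by apply.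
  by rewrite /x -[LHS]subr0 -cE; ring.
Qed.

End Forward.

(** * Both directions assembled, with the converse split by the parity of p *)

Theorem theorem3p6 (L : finFieldType) (p k n : nat) :
  prime p -> p \in [pchar L] -> (0 < k)%N -> odd n ->
  #|L| = ((p ^ k) ^ (2 * n))%N ->
  let q := (p ^ k)%N in
  let m := ((q ^ n + 1) %/ (q + 1))%N in
  (forall G : {set elt L}, is_subgroupB q m G ->
     exists2 h : elt L, Bmem q m h &
       triple_ok p q n m (G0of (conjB q h G)) (G2of (conjB q h G)) (G3of (conjB q h G)))
  /\
  (forall S0 S2 S3 : {set L}, triple_ok p q n m S0 S2 S3 ->
     exists G : {set elt L},
       [/\ is_subgroupB q m G, G0of G = S0, G2of G = S2 & G3of G = S3]).
Proof.
move=> p_pr Lp k0 n_odd cardL q m.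
have q1 : (1 < q)%N by rewrite -(exp1n k) ltn_exp2r // prime_gt1.
have q0 := ltnW q1.
have n0 : (0 < n)%N by case: n n_odd {cardL m}.
have mE : (m * q.+1)%N = (q ^ n).+1 by rewrite /m !addn1 divnK // dvdn_expS_odd.
have m0 : (0 < m)%N by case: (posnP m) mE => // ->.
have Lq : [pchar L].-nat q by rewrite pnatX pnatE // Lp.
split=> [G BG | S0 S2 S3 [[S0mu S0c] [S2F S2K] [S3F S3K WS3]]].
  by exists (bone L); [apply: bone_Bmem | rewrite conjB_bone //; apply: subgroup_triple].
have r0 : (0 < m * (q ^ 2 - 1))%N by rewrite muln_gt0 m0 subn_gt0 -(exp1n 2) ltn_exp2r.
have [g [g0 Sg gS]] := cyclic_setX r0 S0mu S0c.
have S00 : 0 \notin S0.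
  by apply/negP=> /gS[i E]; have := expf_neq0 i g0; rewrite -E eqxx.
have S01 : 1 \in S0 by rewrite -(expr0 g).
have S0M : {in S0 &, forall x y, x * y \in S0}.
  by move=> _ _ /gS[i ->] /gS[j ->]; rewrite -exprD.
have S0V : {in S0, forall x, x^-1 \in S0}.
  by move=> _ /gS[i ->]; rewrite invf_card ?expf_neq0 // -exprM.
rewrite -mE in S3K.
suff [s [sT sC sE]] : exists s, [/\ splits_trace q s S2, cocycle_mod q s S2 S3 &
    {in S0 & S2, forall d b, s (d ^+ m * b) - (d ^+ m) ^+ q.+1 * s b \in S3}].
  exact: (section_subgroup Lq S0mu S01 S00 S0M S0V S2F S2K S3F S3K sT sC sE).
have [S30 S3D S3M] := S3K; have [S20 S2D S2M] := S2K.
case: (eqVneq p 2%N) => [p2 | p2]; last first.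
  have two0 : 2 != 0 :> L by rewrite -(dvdn_pcharf Lp) dvdn_prime2.
  have W : {in S2 &, forall b1 b2, 2^-1 * (b1 * b2 ^+ q - b2 * b1 ^+ q) \in S3}.
    move=> b1 b2 Sb1 Sb2; apply: S3M; first exact: genField_half.
    by apply: (subsetP WS3); rewrite /Wset (negPf p2); apply: imset2_f.
  have [sT sC] := odd_section Lq two0 S2F W.
  exists (fun b => 2^-1 * b ^+ q.+1); split=> // d b _ _.
  by rewrite exprMn mulrCA subrr.
have L2 : 2%N \in [pchar L] by rewrite -p2.
have W : {in S2, forall b, b ^+ q.+1 \in S3}.
  by move=> b Sb; apply: (subsetP WS3); rewrite /Wset p2 eqxx; apply: imset_f.
have [e Fe e1] := trace_one L2 Lq q1 n0 cardL.
have [s [sT sC]] := even_section Lq L2 Fe e1 S2F S20 S2D S3F S30 S3D W.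
have Sg1 : g \in S0 by rewrite -(expr1 g).
have a0 : g ^+ m != 0 by rewrite expf_neq0.
have Fa := Fsub_pow Lq (subsetP S0mu _ Sg1).
have L1 : (0 < #|L|)%N by rewrite ltnW // finNzRing_gt1.
(* The averaging length is [#|L|.-1]: it annihilates every unit and, being odd, equals 1 in L. *)
have aN : (g ^+ m) ^+ #|L|.-1 = 1.
  by apply: (mulIf a0); rewrite mul1r -exprSr prednK ?expf_card.
have N1 : #|L|.-1%:R = 1 :> L.
  apply/eqP; rewrite -subr_eq0 oppr_pchar2 // -mulrSr prednK //.
  by rewrite -(dvdn_pcharf L2) cardL p2 dvdn_exp ?muln_gt0 // dvdn_exp.
have [|c Sc|s' [sT' sC' sE']] := equivariant_average Lq a0 Fa aN N1 _ S30 S3D _ sT sC.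
- by move=> b Sb; apply: S2M => //; apply/mem_genField/imset_f.
- by rewrite -exprM -exprVn; apply: S3M => //; apply/mem_genField/imset_f/S0V.
(* Every element of [S0] is a power of [g], so equivariance under powers of [g ^+ m] covers all of
   them. *)
exists s'; split=> // _ b /gS[i ->] _.
by rewrite -exprM mulnC exprM sE' subrr.
Qed.
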